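(* Let $\mathsf I\subseteq\mathbb R$ be a non-degenerate interval, $h\colon\mathsf I\to\mathbb R$ a function, and $v_1,v_2\in(0,1)$. Consider the condition (Adm2): for any $s_1,s_2,t_1,t_2\in\mathsf I$ such that $s_1\le s_2$ and $t_1\le t_2$, the equalities $(1-v_1)s_1+v_1s_2=(1-v_1)t_1+v_1t_2$ and $(1-v_2)h(s_1)+v_2h(s_2)=(1-v_2)h(t_1)+v_2h(t_2)$ can only hold if $s_1=t_1$ and $s_2=t_2$. (a) Assume that $v_1=v_2$ and $h$ is continuous. Then (Adm2) is satisfied if and only if $h$ is strictly convex or strictly concave. Also, for $h(x)=ax+b$ with $a,b\in\mathbb R$, (Adm2) holds if and only if $a\ne0$ and $v_1\neq v_2$. Moreover, (Adm2) is true if one of the following conditions is satisfied: (b) $v_1<v_2$, and one of the functions $h$, $-h$ is both convex and strictly increasing; (c) $v_1>v_2$, and one of the functions $h$, $-h$ is both convex and strictly decreasing. *)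

(* Defs.v *)
From mathcomp Require Import all_boot all_order all_algebra.
From mathcomp Require Import all_classical all_reals all_analysis.

Set Implicit Arguments.
Unset Strict Implicit.
Unset Printing Implicit Defensive.

Import Order.TTheory GRing.Theory Num.Theory.
Import numFieldNormedType.Exports.

Local Open Scope classical_set_scope.
Local Open Scope ring_scope.
Local Open Scope convex_scope.

Definition nondegenerate_interval (R : realType) (I : set R) :=
  is_interval I /\ exists x y, [/\ I x, I y & x != y].

(* A function h on the interval I is given by a total function on R of which
   only the values on I are used. *)
Definition Adm2 (R : realType) (I : set R) (h : R -> R) (v1 v2 : R) :=
  forall s1 s2 t1 t2 : R, I s1 -> I s2 -> I t1 -> I t2 ->
    s1 <= s2 -> t1 <= t2 ->
    (1 - v1) * s1 + v1 * s2 = (1 - v1) * t1 + v1 * t2 ->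
    (1 - v2) * h s1 + v2 * h s2 = (1 - v2) * h t1 + v2 * h t2 ->
    s1 = t1 /\ s2 = t2.

Definition strictly_convex_function (R : numFieldType) (E : lmodType R)
    (E' := convex_lmodType E) (D : set E') (f : E' -> R^o) :=
  forall t : {i01 R}, 0 < t%:num < 1 ->
    {in D &, forall x y : E', x != y ->
      (f (x <| t |> y) < f x <| t |> f y)%R}.

Definition strictly_concave_function (R : numFieldType) (E : lmodType R)
    (E' := convex_lmodType E) (D : set E') (f : E' -> R^o) :=
  forall t : {i01 R}, 0 < t%:num < 1 ->
    {in D &, forall x y : E', x != y ->
      (f x <| t |> f y < f (x <| t |> y))%R}.

Definition strictly_increasing_on (R : realType) (I : set R) (h : R -> R) :=
  {in I &, {homo h : x y / x < y}}.

Definition strictly_decreasing_on (R : realType) (I : set R) (h : R -> R) :=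
  {in I &, {homo h : x y /~ x < y}}.

(* Main.v *)
(* A failure of (Adm2) amounts to points s1 < t1 <= t2 < s2 of I with
   v1 (s2 - t2) = (1 - v1) (t1 - s1) and
   v2 (h s2 - h t2) = (1 - v2) (h t1 - h s1).
   If h is convex, comparing h t1 and h t2 with the chord of h over [s1, s2]
   turns the second equality into
   v2 (s2 - t2) (h s2 - h s1) <= (1 - v2) (t1 - s1) (h s2 - h s1),
   strictly so for a strictly convex h.  This contradicts the first equality
   if h is strictly convex and v1 = v2, or if the sign of h s2 - h s1 is that
   of v2 - v1.  Conversely, taking t1 = t2 in (Adm2) with v1 = v2 = v shows that
   (1 - v) h x + v h y - h ((1 - v) x + v y) does not vanish for x < y in I.
   The set of such pairs is convex, so for continuous h this expression has a
   constant sign, and a maximum principle for h minus a chord upgrades this to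
   strict convexity or strict concavity. *)
Require Import Defs.
From mathcomp Require Import all_boot all_order all_algebra.
From mathcomp Require Import all_classical all_reals all_analysis.
From mathcomp Require Import ring lra.

Set Implicit Arguments.
Unset Strict Implicit.
Unset Printing Implicit Defensive.

Import Order.TTheory GRing.Theory Num.Theory.
Import numFieldNormedType.Exports.

Local Open Scope classical_set_scope.
Local Open Scope ring_scope.

(** * Chord inequalities for convex and strictly convex functions *)

Section ChordInequalities.
Context {R : realType}.
Implicit Types (I : set R) (h : R -> R).

(** Here [p] is the convex combination of [x] and [y] with weight [(y - p) / (y - x)] on [x].
    Multiplying by [y - x] clears the denominator, so that later uses are polynomial. *)
Lemma convex_function_chord I h x p y :
  convex_function (E := R^o) I h -> I x -> I y -> x < y -> x <= p <= y ->
  (y - x) * h p <= (y - p) * h x + (p - x) * h y.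
Proof.
move=> hh Ix Iy xy /andP[xp py].
have d0 : 0 < y - x by rewrite subr_gt0.
have t0 : 0 <= (y - p) / (y - x) by apply: divr_ge0; lra.
have t1 : (y - p) / (y - x) <= 1 by rewrite ler_pdivrMr// mul1r; lra.
have : h ((y - p) / (y - x) * x + (1 - (y - p) / (y - x)) * y) <=
    (y - p) / (y - x) * h x + (1 - (y - p) / (y - x)) * h y.
  exact: (hh (Itv01 t0 t1) x y (mem_set Ix) (mem_set Iy)).
have -> : (y - p) / (y - x) * x + (1 - (y - p) / (y - x)) * y = p.
  by field; rewrite gt_eqF.
move=> /(ler_wpM2l (ltW d0)).
congr (_ <= _); field; rewrite gt_eqF//.
Qed.

Lemma strictly_convex_functionP I h :
  strictly_convex_function (E := R^o) I h <->
  forall x p y, I x -> I y -> x < p < y ->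
    (y - x) * h p < (y - p) * h x + (p - x) * h y.
Proof.
split=> [hh x p y Ix Iy /andP[xp py]|hh t /andP[t0 t1]].
  have d0 : 0 < y - x by rewrite subr_gt0 (lt_trans xp).
  have t0 : 0 < (y - p) / (y - x) by apply: divr_gt0; lra.
  have t1 : (y - p) / (y - x) < 1 by rewrite ltr_pdivrMr// mul1r; lra.
  have t01 : 0 < (y - p) / (y - x) < 1 by rewrite t0.
  have : h ((y - p) / (y - x) * x + (1 - (y - p) / (y - x)) * y) <
      (y - p) / (y - x) * h x + (1 - (y - p) / (y - x)) * h y.
    apply: (hh (Itv01 (ltW t0) (ltW t1)) t01 x y (mem_set Ix) (mem_set Iy)).
    by rewrite lt_eqF// (lt_trans xp).
  have -> : (y - p) / (y - x) * x + (1 - (y - p) / (y - x)) * y = p.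
    by field; rewrite gt_eqF.
  rewrite -(ltr_pM2l d0).
  congr (_ < _); field; rewrite gt_eqF//.
suff H (x y : R) : I x -> I y -> x != y ->
    h (t%:num * x + (1 - t%:num) * y) < t%:num * h x + (1 - t%:num) * h y.
  by move=> x y /set_mem Ix /set_mem Iy; exact: H.
move: (t%:num) t0 t1 => {}t t0 t1 Ix Iy.
(* The definition only asks for [x != y], whereas the chord form needs ordered endpoints. *)
case: (ltgtP x y) => // [xy|yx] _.
  have d0 : 0 < y - x by rewrite subr_gt0.
  have tp : x < t * x + (1 - t) * y < y by apply/andP; split; nra.
  have := hh _ _ _ Ix Iy tp.
  by rewrite -[in X in _ -> X](ltr_pM2l d0); congr (_ < _); ring.
have d0 : 0 < x - y by rewrite subr_gt0.
have tp : y < t * x + (1 - t) * y < x by apply/andP; split; nra.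
have := hh _ _ _ Iy Ix tp.
by rewrite -[in X in _ -> X](ltr_pM2l d0); congr (_ < _); ring.
Qed.

Lemma strictly_concave_functionE I h :
  strictly_concave_function (E := R^o) I h <->
  strictly_convex_function (E := R^o) I (\- h).
Proof.
split=> hh t t01 x y Ix Iy xy; have := hh t t01 x y Ix Iy xy;
  by rewrite /= -convN ltrN2.
Qed.

End ChordInequalities.

(** * (Adm2) from convexity, and the affine case *)

Section Adm2Theory.
Context {R : realType}.
Implicit Types (I : set R) (h : R -> R) (v : R).

Lemma Adm2N I h v1 v2 : Adm2 I (\- h) v1 v2 -> Adm2 I h v1 v2.
Proof.
move=> hA s1 s2 t1 t2 Is1 Is2 It1 It2 s12 t12 E1 E2.
by apply: hA => //=; lra.
Qed.

(** Two pairs with the same [v1]-mean either share both endpoints or have one strictly enclosing the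
    other: raising the left endpoint forces the right one down. The two enclosing cases are
    symmetric. *)
Lemma Adm2_nested I h v1 v2 : 0 < v1 < 1 ->
  (forall s1 s2 t1 t2, I s1 -> I s2 -> I t1 -> I t2 ->
    s1 < t1 -> t1 <= t2 -> t2 < s2 ->
    v1 * (s2 - t2) = (1 - v1) * (t1 - s1) ->
    v2 * (h s2 - h t2) = (1 - v2) * (h t1 - h s1) -> False) ->
  Adm2 I h v1 v2.
Proof.
move=> /andP[v0 v1'] hA s1 s2 t1 t2 Is1 Is2 It1 It2 s12 t12 E1 E2.
case: (ltgtP s1 t1) => [st|ts|st].
- exfalso; have ts : t2 < s2 by nra.
  by apply: (hA s1 s2 t1 t2) => //; lra.
- exfalso; have st : s2 < t2 by nra.
  by apply: (hA t1 t2 s1 s2) => //; lra.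
- split=> //; move: E1; rewrite st => /addrI.
  by move/(mulfI (lt0r_neq0 v0)).
Qed.

Lemma strictly_convex_Adm2 I h v : 0 < v < 1 ->
  strictly_convex_function (E := R^o) I h -> Adm2 I h v v.
Proof.
move=> v01 /strictly_convex_functionP hh; apply: Adm2_nested => //.
move=> s1 s2 t1 t2 Is1 Is2 It1 It2 st t12 ts E1 E2.
have /andP[v0 v1] := v01.
have H1 : (s2 - s1) * h t1 < (s2 - t1) * h s1 + (t1 - s1) * h s2.
  by apply: hh => //; rewrite st (le_lt_trans t12).
have H2 : (s2 - s1) * h t2 < (s2 - t2) * h s1 + (t2 - s1) * h s2.
  by apply: hh => //; rewrite ts (lt_le_trans st).
have H1' : (1 - v) * ((s2 - s1) * (h t1 - h s1)) <
    (1 - v) * ((t1 - s1) * (h s2 - h s1)).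
  by rewrite ltr_pM2l ?subr_gt0//; lra.
have H2' : v * ((s2 - t2) * (h s2 - h s1)) < v * ((s2 - s1) * (h s2 - h t2)).
  by rewrite ltr_pM2l//; lra.
(* After scaling, both equalities involve the same products as [H1'] and [H2'], and the
   contradiction becomes linear in these products. *)
have E1' := congr1 (fun z => z * (h s2 - h s1)) E1.
have E2' := congr1 (fun z => (s2 - s1) * z) E2.
by move: E1' E2' => /= E1' E2'; lra.
Qed.

(* Both gaps [t1 - s1], [s2 - t2] are compared through the chord of [h] over
   [[s1, s2]], so that [h] enters only via the sign of [h s2 - h s1]. *)
Lemma convex_nested I h v2 s1 s2 t1 t2 : 0 < v2 < 1 ->
  convex_function (E := R^o) I h -> I s1 -> I s2 ->
  s1 < t1 -> t1 <= t2 -> t2 < s2 ->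
  v2 * (h s2 - h t2) = (1 - v2) * (h t1 - h s1) ->
  v2 * (s2 - t2) * (h s2 - h s1) <= (1 - v2) * (t1 - s1) * (h s2 - h s1).
Proof.
move=> /andP[v0 v1] hh Is1 Is2 st t12 ts E2.
have s12 : s1 < s2 by exact: lt_le_trans st (le_trans t12 (ltW ts)).
have H1 : (s2 - s1) * h t1 <= (s2 - t1) * h s1 + (t1 - s1) * h s2.
  by apply: (convex_function_chord hh) => //; apply/andP; split; lra.
have H2 : (s2 - s1) * h t2 <= (s2 - t2) * h s1 + (t2 - s1) * h s2.
  by apply: (convex_function_chord hh) => //; apply/andP; split; lra.
have H1' : (1 - v2) * ((s2 - s1) * (h t1 - h s1)) <=
    (1 - v2) * ((t1 - s1) * (h s2 - h s1)).
  by rewrite ler_pM2l ?subr_gt0//; lra.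
have H2' : v2 * ((s2 - t2) * (h s2 - h s1)) <= v2 * ((s2 - s1) * (h s2 - h t2)).
  by rewrite ler_pM2l//; lra.
have E2' := congr1 (fun z => (s2 - s1) * z) E2.
by move: E2' => /= E2'; lra.
Qed.

Lemma convex_incr_Adm2 I h v1 v2 : 0 < v1 < 1 -> 0 < v2 < 1 -> v1 < v2 ->
  convex_function (E := R^o) I h -> strictly_increasing_on I h ->
  Adm2 I h v1 v2.
Proof.
move=> v101 v201 v12 hc hm; apply: Adm2_nested => //.
move=> s1 s2 t1 t2 Is1 Is2 It1 It2 st t12 ts E1 E2.
have := convex_nested v201 hc Is1 Is2 st t12 ts E2.
(* Cancelling [h s2 - h s1 > 0] leaves [v2 * (s2 - t2) <= (1 - v2) * (t1 - s1)], which [E1] excludes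
   because [v1 < v2]. *)
rewrite ler_pM2r; last first.
  rewrite subr_gt0; apply: hm; rewrite ?inE//.
  exact: lt_le_trans st (le_trans t12 (ltW ts)).
by move: v101 v201 => /andP[? ?] /andP[? ?]; nra.
Qed.

Lemma convex_decr_Adm2 I h v1 v2 : 0 < v1 < 1 -> 0 < v2 < 1 -> v2 < v1 ->
  convex_function (E := R^o) I h -> strictly_decreasing_on I h ->
  Adm2 I h v1 v2.
Proof.
move=> v101 v201 v12 hc hm; apply: Adm2_nested => //.
move=> s1 s2 t1 t2 Is1 Is2 It1 It2 st t12 ts E1 E2.
have := convex_nested v201 hc Is1 Is2 st t12 ts E2.
(* Now [h s2 - h s1 < 0], so cancelling it reverses the inequality, and [E1] excludes the result
   because [v2 < v1]. *)
rewrite ler_nM2r; last first.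
  rewrite subr_lt0; apply: hm; rewrite ?inE//.
  exact: lt_le_trans st (le_trans t12 (ltW ts)).
by move: v101 v201 => /andP[? ?] /andP[? ?]; nra.
Qed.

Lemma mean_in_interval I v x y : is_interval I -> 0 < v < 1 ->
  I x -> I y -> x <= y -> I ((1 - v) * x + v * y).
Proof.
move=> hI /andP[v0 v1] Ix Iy xy; apply: (hI x y) => //.
by apply/andP; split; nra.
Qed.

(** Equality would let the pair [x], [y] be confused with the constant pair at its [v1]-mean. *)
Lemma Adm2_mean_neq I h v1 v2 x y : is_interval I -> 0 < v1 < 1 ->
  Adm2 I h v1 v2 -> I x -> I y -> x < y ->
  (1 - v2) * h x + v2 * h y != h ((1 - v1) * x + v1 * y).
Proof.
move=> hI hv1 hA Ix Iy xy; apply/eqP => E.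
have Ic := mean_in_interval hI hv1 Ix Iy (ltW xy).
have := hA x y _ _ Ix Iy Ic Ic (ltW xy) (lexx _).
move: E; set c := (1 - v1) * x + v1 * y => E [||xc yc]; [lra|lra|].
by move: xy; rewrite xc yc ltxx.
Qed.

Lemma affine_Adm2 I h v1 v2 a b : nondegenerate_interval I ->
  0 < v1 < 1 -> 0 < v2 < 1 -> (forall x, I x -> h x = a * x + b) ->
  Adm2 I h v1 v2 <-> a <> 0 /\ v1 <> v2.
Proof.
move=> [hI [x0 [y0 [Ix0 Iy0 xy0]]]] hv1 hv2 hab.
split=> [hA|[a0 v12]].
  have [x [y [Ix Iy xy]]] : exists x y, [/\ I x, I y & x < y].
    by move: xy0; case: ltgtP => // ? _; [exists x0, y0|exists y0, x0].
  have := Adm2_mean_neq hI hv1 hA Ix Iy xy.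
  rewrite !hab//; last exact: mean_in_interval (ltW xy).
  (* For affine [h], the two sides of [N] differ by [a * (v2 - v1) * (y - x)]. *)
  by move=> /eqP N; split=> E; apply: N; rewrite E; ring.
apply: Adm2_nested => // s1 s2 t1 t2 Is1 Is2 It1 It2 st t12 ts E1.
rewrite !hab// => E2; apply: v12.
have {}E2 : v2 * (s2 - t2) = (1 - v2) * (t1 - s1).
  by move/eqP : a0 => a0; apply: (mulfI a0); lra.
have {E1 E2}/eqP : (v1 - v2) * ((t1 - s1) + (s2 - t2)) = 0 by lra.
by rewrite mulf_eq0 => /orP[/eqP|/eqP]; lra.
Qed.

End Adm2Theory.

(** * Continuous functions with equal weights *)

Section ContinuousCase.
Context {R : realType}.
Implicit Types (I : set R) (h : R -> R) (v : R).

(** Projecting onto [[a, b]] first extends the restriction of [h] to a function continuous on the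
    whole line, so continuity relative to [I] need not be carried through compositions. *)
Lemma continuous_clamp I h a b : is_interval I -> I a -> I b -> a <= b ->
  {within I, continuous h} ->
  continuous (fun x => h (Num.max a (Num.min b x))).
Proof.
move=> hI Ia Ib ab /subspace_continuousP hc x.
pose c (z : R) := Num.max a (Num.min b z).
have Ic z : I (c z).
  by apply: (hI a b) => //; rewrite /c le_max lexx/= ge_max ab ge_min lexx.
have cc : {for x, continuous c}.
  apply: continuous_max; first exact: cst_continuous.
  by apply: continuous_min; [exact: cst_continuous|].
apply: (@cvg_comp _ _ _ c h _ (within I (nbhs (c x)))); last exact: hc.
move=> A; rewrite /within/= => nA.
have : \forall z \near x, I (c z) -> A (c z) := cc _ nA.
by apply: filterS => z; apply.
Qed.

(** Move from [(x, y)] to [(x', y')] along a segment. If the signs differed, the intermediate value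
    theorem would give an ordered pair on it where the gap vanishes. *)
Lemma gap_same_sign I h v x y x' y' : is_interval I -> 0 < v < 1 ->
  {within I, continuous h} ->
  (forall x y, I x -> I y -> x < y ->
    (1 - v) * h x + v * h y != h ((1 - v) * x + v * y)) ->
  I x -> I y -> x < y -> I x' -> I y' -> x' < y' ->
  (1 - v) * h x + v * h y < h ((1 - v) * x + v * y) ->
  (1 - v) * h x' + v * h y' < h ((1 - v) * x' + v * y').
Proof.
move=> hI hv hc hN Ix Iy xy Ix' Iy' xy' neg.
have /andP[v0 v1] := hv.
case: (ltgtP _ (h _)) (hN _ _ Ix' Iy' xy') => // pos _; exfalso.
(* [[a, b]] contains every point met along the segment, so [k] agrees with [h] there. *)
pose a := Num.min x x'; pose b := Num.max y y'.
have Ia : I a by rewrite /a; case: (leP x x').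
have Ib : I b by rewrite /b; case: (leP y y').
have [ax ax'] : a <= x /\ a <= x' by rewrite /a !ge_min !lexx orbT.
have [yb yb'] : y <= b /\ y' <= b by rewrite /b !le_max !lexx orbT.
have ab : a <= b by lra.
pose k z := h (Num.max a (Num.min b z)).
have kE z : a <= z <= b -> k z = h z.
  by move=> /andP[az zb]; rewrite /k (min_idPr zb) (max_idPr az).
have kc : continuous k by exact: continuous_clamp hI Ia Ib ab hc.
pose X (t : R) := x + t * (x' - x); pose Y (t : R) := y + t * (y' - y).
have affc (p q : R) : continuous (fun t : R => p + t * q).
  by move=> t; apply: cvgD; [exact: cvg_cst|apply: cvgM; [|exact: cvg_cst]].
pose G t := (1 - v) * k (X t) + v * k (Y t) - k ((1 - v) * X t + v * Y t).
have Gc : continuous G.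
  have kX : continuous (fun t => k (X t)).
    by move=> t; apply: (continuous_comp (affc _ _ t)); exact: kc.
  have kY : continuous (fun t => k (Y t)).
    by move=> t; apply: (continuous_comp (affc _ _ t)); exact: kc.
  have kZ : continuous (fun t => k ((1 - v) * X t + v * Y t)).
    move=> t; apply: (@continuous_comp _ _ _ (fun t => (1 - v) * X t + v * Y t) k).
      apply: cvgD; apply: cvgM; [exact: cvg_cst|exact: affc|exact: cvg_cst|].
      exact: affc.
    exact: kc.
  move=> t; apply: cvgB; last exact: kZ.
  by apply: cvgD; apply: cvgM; [exact: cvg_cst|exact: kX|exact: cvg_cst|exact: kY].
have [|t] := @IVT _ G 0 1 0 ler01 (continuous_subspaceT Gc).
  have -> : G 0 = (1 - v) * h x + v * h y - h ((1 - v) * x + v * y).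
    by rewrite /G /X /Y !mul0r !addr0 !kE//; apply/andP; split; nra.
  have -> : G 1 = (1 - v) * h x' + v * h y' - h ((1 - v) * x' + v * y').
    rewrite /G /X /Y !mul1r.
    have -> : x + (x' - x) = x' by ring.
    have -> : y + (y' - y) = y' by ring.
    by rewrite !kE//; apply/andP; split; nra.
  by rewrite ge_min le_max !subr_ge0 !subr_le0 (ltW neg) (ltW pos) orbT.
rewrite in_itv/= => /andP[t0 t1] Gt.
have XY : X t < Y t.
  (* [Y t - X t] is [(1 - t) * (y - x) + t * (y' - x')]; the split tells which weight is surely
     positive. *)
  by rewrite /X /Y; case: (leP t (1 / 2)) => th; nra.
have aX : a <= X t by rewrite /X; nra.
have Yb : Y t <= b by rewrite /Y; nra.
have IX : I (X t) by apply: (hI a b) => //; apply/andP; split; lra.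
have IY : I (Y t) by apply: (hI a b) => //; apply/andP; split; lra.
move/eqP: (hN _ _ IX IY XY); apply; move: Gt; rewrite /G !kE; first lra.
all: by apply/andP; split; nra.
Qed.

(* An interior maximum of [h] minus its chord would violate the hypothesis,
   since that maximum is a [v]-mean of two nearby points. *)
Lemma gap_pos_strictly_convex I h v : is_interval I -> 0 < v < 1 ->
  {within I, continuous h} ->
  (forall x y, I x -> I y -> x < y ->
    h ((1 - v) * x + v * y) < (1 - v) * h x + v * h y) ->
  strictly_convex_function (E := R^o) I h.
Proof.
move=> hI hv hc hgap; apply/strictly_convex_functionP => x p y Ix Iy /andP[xp py].
have /andP[v0 v1] := hv.
have xy : x < y by exact: lt_trans py.
rewrite ltNge; apply/negP => hp.
pose k z := (y - x) * h z - ((y - z) * h x + (z - x) * h y).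
have Isub : `[x, y] `<=` I.
  by move=> z; rewrite /= in_itv/= => xzy; exact: (hI x y).
have kc : {within `[x, y], continuous k}.
  have {}hc := continuous_subspaceW Isub hc.
  move=> z; apply: cvgB; first by apply: cvgM; [exact: cvg_cst|exact: hc].
  have idc : {for z, continuous (id : subspace `[x, y] -> R)}.
    by apply: (@continuous_subspaceT _ _ `[x, y] id) => u; exact: cvg_id.
  apply: cvgD; apply: cvgM; try exact: cvg_cst.
    by apply: cvgB; [exact: cvg_cst|exact: idc].
  by apply: cvgB; [exact: idc|exact: cvg_cst].
have kx : k x = 0 by rewrite /k; ring.
have ky : k y = 0 by rewrite /k; ring.
have kp : 0 <= k p by rewrite /k subr_ge0.
(* The chord is affine and has zero gap, so [k] inherits the gap inequality of [h]. *)
have kgap z w : x <= z -> z < w -> w <= y ->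
    k ((1 - v) * z + v * w) < (1 - v) * k z + v * k w.
  move=> xz zw wy.
  have Iz : I z by apply: (hI x y) => //; apply/andP; split; lra.
  have Iw : I w by apply: (hI x y) => //; apply/andP; split; lra.
  have := hgap z w Iz Iw zw.
  have d0 : 0 < y - x by rewrite subr_gt0.
  by rewrite -(ltr_pM2l d0) /k; lra.
have [q [xq qy qmax]] : exists q, [/\ x < q, q < y &
    forall z, x <= z -> z <= y -> k z <= k q].
  have [c] := EVT_max (ltW xy) kc; rewrite in_itv/= => /andP[xc cy] cmax.
  have {}cmax z : x <= z -> z <= y -> k z <= k c.
    by move=> xz zy; apply: cmax; rewrite in_itv/= xz zy.
  have [kc0|kc0] := leP (k c) 0.
    (* If the maximum is at most 0, then [p] attains it, since [0 <= k p]; otherwise the maximiser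
       is interior because [k] vanishes at [x] and [y]. *)
    exists p; split=> // z xz zy.
    by rewrite (le_trans (cmax _ xz zy))// (le_trans kc0).
  exists c; split=> //.
    by rewrite lt_neqAle xc andbT; apply/eqP => E; move: kc0; rewrite -E kx ltxx.
  by rewrite lt_neqAle cy andbT; apply/eqP => E; move: kc0; rewrite E ky ltxx.
(* With this [e], the points [q - v * e] and [q + (1 - v) * e] stay in [[x, y]] and have [v]-mean
   [q]. *)
pose e := Num.min (q - x) (y - q).
have e0 : 0 < e by rewrite lt_min !subr_gt0 xq qy.
have [eqx eyq] : e <= q - x /\ e <= y - q by rewrite /e !ge_min !lexx orbT.
have := kgap (q - v * e) (q + (1 - v) * e).
have -> : (1 - v) * (q - v * e) + v * (q + (1 - v) * e) = q by ring.
have l1 : x <= q - v * e by nra.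
have l2 : q - v * e < q + (1 - v) * e by nra.
have l3 : q + (1 - v) * e <= y by nra.
move=> /(_ l1 l2 l3).
have m1 : k (q - v * e) <= k q by apply: qmax => //; lra.
have m2 : k (q + (1 - v) * e) <= k q by apply: qmax => //; lra.
have n1 : 0 <= (1 - v) * (k q - k (q - v * e)) by rewrite mulr_ge0// subr_ge0// ltW.
have n2 : 0 <= v * (k q - k (q + (1 - v) * e)) by rewrite mulr_ge0 ?subr_ge0// ltW.
lra.
Qed.

Lemma Adm2_strictly_convex_or_concave I h v : is_interval I -> 0 < v < 1 ->
  {within I, continuous h} -> Adm2 I h v v ->
  strictly_convex_function (E := R^o) I h \/
  strictly_concave_function (E := R^o) I h.
Proof.
move=> hI hv hc hA.
have hN x y := @Adm2_mean_neq _ I h v v x y hI hv hA.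
have [[x [y [Ix Iy xy neg]]]|nex] := pselect (exists x y,
    [/\ I x, I y, x < y & (1 - v) * h x + v * h y < h ((1 - v) * x + v * y)]).
  right; apply/strictly_concave_functionE.
  apply: (gap_pos_strictly_convex hI hv) => [z|x' y' Ix' Iy' xy'].
    by apply: cvgN; exact: hc.
  by have := gap_same_sign hI hv hc hN Ix Iy xy Ix' Iy' xy' neg; move=> /=; lra.
left; apply: (gap_pos_strictly_convex hI hv hc) => x y Ix Iy xy.
case: ltgtP (hN x y Ix Iy xy) => // neg _.
by exfalso; apply: nex; exists x, y.
Qed.

End ContinuousCase.

Theorem theorem3p2 (R : realType) (I : set R) (h : R -> R) (v1 v2 : R)
    (hI : nondegenerate_interval I)
    (hv1 : 0 < v1 < 1) (hv2 : 0 < v2 < 1) :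
  [/\ (v1 = v2 -> {within I, continuous h} ->
        (Adm2 I h v1 v2 <->
         strictly_convex_function (E := R^o) I h \/ strictly_concave_function (E := R^o) I h)),
      (forall a b : R, (forall x, I x -> h x = a * x + b) ->
        (Adm2 I h v1 v2 <-> a <> 0 /\ v1 <> v2)),
      (v1 < v2 ->
        (convex_function (E := R^o) I h /\ strictly_increasing_on I h) \/
        (convex_function (E := R^o) I (\- h) /\ strictly_increasing_on I (\- h)) ->
        Adm2 I h v1 v2)
    & (v1 > v2 ->
        (convex_function (E := R^o) I h /\ strictly_decreasing_on I h) \/
        (convex_function (E := R^o) I (\- h) /\ strictly_decreasing_on I (\- h)) ->
        Adm2 I h v1 v2)].
Proof.
split.
- move=> v12 hc; rewrite -v12; split.
    exact: Adm2_strictly_convex_or_concave hI.1 hv1 hc.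
  case=> [|/strictly_concave_functionE] hs; first exact: strictly_convex_Adm2.
  exact/Adm2N/strictly_convex_Adm2.
- by move=> a b; exact: affine_Adm2.
- move=> v12 [[hc hm]|[hc hm]]; first exact: convex_incr_Adm2.
  exact/Adm2N/convex_incr_Adm2.
- move=> v12 [[hc hm]|[hc hm]]; first exact: convex_decr_Adm2.
  exact/Adm2N/convex_decr_Adm2.
Qed.
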